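(* Let $T$ be a reduced ring with $|T|=2^{2^{\aleph_0}}$. Then either $T$ has a maximal subring, or $|\mathrm{Max}(T)|=2^{\aleph_0}$ and the intersection of each countable family of maximal ideals of $T$ is nonzero.
   Context: All rings are commutative with $1\neq0$ and subrings are unital. A maximal subring of $T$ is a proper subring maximal with respect to inclusion among proper subrings of $T$. $\mathrm{Max}(T)$ denotes the set of maximal ideals of $T$. *)

(* Defs.v *)
From mathcomp Require Import all_boot all_order all_algebra.
From mathcomp Require Import boolp classical_sets functions cardinality.
Set Implicit Arguments. Unset Strict Implicit. Unset Printing Implicit Defensive.
Import GRing.Theory.
Local Open Scope ring_scope.
Local Open Scope classical_set_scope.

Definition reduced (R : comNzRingType) : Prop :=
  forall (x : R) (n : nat), x ^+ n = 0 -> x = 0.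

Definition is_ideal (R : comNzRingType) (I : set R) : Prop :=
  [/\ I 0, (forall x y, I x -> I y -> I (x - y)) & (forall r x, I x -> I (r * x))].

Definition maximal_ideal (R : comNzRingType) (I : set R) : Prop :=
  [/\ is_ideal I, I <> setT &
      forall J : set R, is_ideal J -> I `<=` J -> J <> setT -> J = I].

Definition MaxSpec (R : comNzRingType) : set (set R) :=
  [set I | maximal_ideal I].

Definition is_subring (R : comNzRingType) (S : set R) : Prop :=
  [/\ S 1, (forall x y, S x -> S y -> S (x - y)) & (forall x y, S x -> S y -> S (x * y))].

Definition maximal_subring (R : comNzRingType) (S : set R) : Prop :=
  [/\ is_subring S, S <> setT &
      forall S' : set R, is_subring S' -> S `<=` S' -> S' <> setT -> S' = S].

(* Main.v *)
(* A reduced ring [T] without maximal subrings has at most [2^aleph_0] elements,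
   so under the cardinality hypothesis the first alternative always holds.

   Let [x], [y] be elements of [T] and [v] a valuation of rank one on the residue
   field of a prime [P] with [v x > 0] and [v (1 - x y) > 0].  By Zorn's lemma
   there is a subring containing the preimage of the valuation ring and maximal
   among those in which [x] and [1 - x y] do not generate the unit ideal; it is a
   maximal subring of [T], since any larger ring [R] has [(x, 1 - x y)^N = R] and
   [(x, 1 - x y)^N t] consists of elements of nonnegative value for [N] large.
   If [x], [y] are algebraically independent modulo [P] such a valuation exists
   (take [x] as uniformizer over a field containing [1/x - y]).  Hence without
   maximal subrings every [T/P] has transcendence degree at most one and is
   countable.  The case [x y = 1] similarly forces units of [T] to be algebraic
   modulo [P], whence [T/P] has zero Jacobson radical.

   If [T/P] and [T/Q] are isomorphic with [P <> Q], two distinct maximal ideals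
   have isomorphic residue fields, and the equalizer of the two residue maps is a
   proper subring over which [T] is generated by one element.  So primes are
   determined by the isomorphism type of a countable ring: [Spec T] has at most
   [2^aleph_0] points.  Finally, compactness of the constructible topology shows
   that an element of [T] is determined by finitely many data taken from [Spec T]
   and the countable quotients. *)
Require Import Defs.
From HB Require Import structures.
From mathcomp Require Import all_boot all_order all_algebra ring zify.
From mathcomp Require Import boolp classical_sets functions cardinality filter.
Set Implicit Arguments. Unset Strict Implicit. Unset Printing Implicit Defensive.
Import GRing.Theory.
Local Open Scope ring_scope.
Local Open Scope classical_set_scope.

(** * Residue fields of primes *)

Definition prime_ideal (R : comNzRingType) (P : set R) : Prop :=
  [/\ is_ideal P, ~ P 1 & forall x y, P (x * y) -> P x \/ P y].

Section ResidueField.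
Variables (T : comNzRingType) (P : set T) (primeP : prime_ideal P).

(** The primality proof is an argument so that the ideal structures declared below can be inferred
    from the term. *)
Definition prime_pred (_ : prime_ideal P) (x : T) : bool := `[< P x >].
Local Notation I := (prime_pred primeP).

Lemma prime_pred_idealr : idealr_closed I.
Proof.
have [[P0 PB PM] P1 _] := primeP.
split; rewrite ?/in_mem /=; first exact/asboolP.
  by apply/negP=> /asboolP.
move=> a x y /asboolP Px /asboolP Py; apply/asboolP.
rewrite -[y]opprK -[- y]sub0r; apply: (PB); first exact: PM.
exact: PB.
Qed.

Lemma prime_pred_prime : prime_idealr_closed I.
Proof.
have [_ _ PP] := primeP.
move=> u v /asboolP /PP[Pu|Pv]; apply/orP; [left|right]; exact/asboolP.
Qed.

HB.instance Definition _ := isIdealr.Build T (prime_pred primeP)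
  prime_pred_idealr.
HB.instance Definition _ := isPrimeIdealrClosed.Build T (prime_pred primeP)
  prime_pred_prime.

Definition prime_idealr_of := PrimeIdealr.clone T (prime_pred primeP) _.
Definition prime_quot := {ideal_quot prime_idealr_of}.
HB.instance Definition _ := GRing.ComNzRing.on prime_quot.

Lemma prime_quot_integral (x y : prime_quot) : x * y = 0 -> (x == 0) || (y == 0).
Proof. exact: Quotient.rquot_IdomainAxiom. Qed.

Definition prime_quot_unit : pred prime_quot := fun x => `[< exists y, y * x = 1 >].
Definition prime_quot_inv (x : prime_quot) : prime_quot :=
  if pselect (exists y, y * x = 1) is left h then projT1 (cid h) else x.

Lemma prime_quot_mulVx : {in prime_quot_unit, left_inverse 1 prime_quot_inv *%R}.
Proof.
move=> x; rewrite /in_mem /= => /asboolP xU; rewrite /prime_quot_inv.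
by case: pselect => // h; case: cid.
Qed.

Lemma prime_quot_unitPl (x y : prime_quot) : y * x = 1 -> prime_quot_unit x.
Proof. by move=> yx; apply/asboolP; exists y. Qed.

Lemma prime_quot_inv_out : {in [predC prime_quot_unit], prime_quot_inv =1 id}.
Proof.
move=> x; rewrite inE /in_mem /= => /asboolP xU; rewrite /prime_quot_inv.
by case: pselect.
Qed.

HB.instance Definition _ := GRing.ComNzRing_hasMulInverse.Build prime_quot
  prime_quot_mulVx prime_quot_unitPl prime_quot_inv_out.
HB.instance Definition _ := GRing.ComUnitRing_isIntegral.Build prime_quot
  prime_quot_integral.

Lemma residue_field : exists (K : fieldType) (f : {rmorphism T -> K}),
  forall x, f x = 0 <-> P x.
Proof.
exists {fraction prime_quot}.
exists (@tofrac prime_quot \o (\pi_prime_quot)%qT : {rmorphism T -> _}).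
move=> x /=; split=> [/eqP|Px].
  rewrite tofrac_eq0 => /eqP px0; apply/asboolP.
  change (x \in I); rewrite -[x]subr0 Quotient.idealrBE.
  by apply/eqP; rewrite [LHS]px0 [RHS]rmorph0.
suff -> : (\pi_prime_quot x)%qT = 0 by rewrite rmorph0.
have : x - 0 \in I by rewrite subr0; exact/asboolP.
rewrite Quotient.idealrBE => /eqP; rewrite /prime_quot => ->.
exact: rmorph0.
Qed.
End ResidueField.

(** * Ideals, subrings and Zorn's lemma *)

Lemma Zorn_above (X : Type) (Q : set (set X)) (A : set X) : Q A ->
  (forall F, F `<=` Q -> F !=set0 -> total_on F subset -> Q (\bigcup_(Y in F) Y)) ->
  exists M, [/\ Q M, A `<=` M & forall B, Q B -> M `<=` B -> B = M].
Proof.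
move=> QA Qchain.
(* [Zorn_bigcup] also asks about the empty chain; for the sets whose union with [A] satisfies [Q],
   that case is [Q A]. *)
have [|B [QB maxB]] := @Zorn_bigcup X [set B | Q (A `|` B)].
  move=> F FQ Ftot /=.
  have [->|/set0P F0] := eqVneq F set0; first by rewrite bigcup_set0 setU0.
  have -> : A `|` \bigcup_(Y in F) Y = \bigcup_(Z in [set A `|` Y | Y in F]) Z.
    apply/seteqP; split=> [x [Ax|[Y FY Yx]]|x [_ [Y FY <-] [Ax|Yx]]].
    - by have [Y FY] := F0; exists (A `|` Y); [exists Y|left].
    - by exists (A `|` Y); [exists Y|right].
    - by left.
    - by right; exists Y.
  apply: Qchain.
  - by move=> _ [Y FY <-]; exact: FQ.
  - by have [Y FY] := F0; exists (A `|` Y); exists Y.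
  - move=> _ _ [Y FY <-] [Z FZ <-].
    by have [YZ|ZY] := Ftot _ _ FY FZ; [left|right]; exact: setUS.
exists (A `|` B); split=> // C QC ABC.
have AC : A `|` C = C.
  by apply/setUidPr => x Ax; apply: ABC; left.
have BC : B `<=` C by move=> x Bx; apply: ABC; right.
have [CB|CB] := pselect (C `<=` B).
  by apply/seteqP; split=> // x Cx; right; exact: CB.
by have /(_ (conj BC CB)) := maxB C; rewrite /= AC.
Qed.

Lemma chain_pair (X : Type) (F : set (set X)) (x y : X) : total_on F subset ->
  (\bigcup_(Y in F) Y) x -> (\bigcup_(Y in F) Y) y ->
  exists Z, [/\ F Z, Z x & Z y].
Proof.
move=> Ftot [Y FY Yx] [Z FZ Zy].
have [YZ|ZY] := Ftot _ _ FY FZ; first by exists Z; split=> //; exact: YZ.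
by exists Y; split=> //; exact: ZY.
Qed.

Section Ideals.
Variable T : comNzRingType.
Implicit Types (I J P : set T).

Lemma ideal0 I : is_ideal I -> I 0. Proof. by case. Qed.
Lemma idealB I x y : is_ideal I -> I x -> I y -> I (x - y).
Proof. by case=> _ h _; exact: h. Qed.
Lemma ideal_mull I r x : is_ideal I -> I x -> I (r * x).
Proof. by case=> _ _; exact. Qed.
Lemma ideal_mulr I r x : is_ideal I -> I x -> I (x * r).
Proof. by rewrite mulrC; exact: ideal_mull. Qed.
Lemma idealN I x : is_ideal I -> I x -> I (- x).
Proof. by move=> iI Ix; rewrite -sub0r; apply: idealB => //; exact: ideal0. Qed.
Lemma idealD I x y : is_ideal I -> I x -> I y -> I (x + y).
Proof. by move=> iI Ix Iy; rewrite -[y]opprK; apply: idealB => //; exact: idealN. Qed.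

Definition ideal_add I (a : T) : set T := [set x | exists r, I (x - r * a)].

Lemma ideal_add_ideal I a : is_ideal I -> is_ideal (ideal_add I a).
Proof.
move=> iI; split.
- by exists 0; rewrite mul0r subrr; exact: ideal0.
- move=> x y [r xr] [s ys]; exists (r - s).
  have -> : x - y - (r - s) * a = (x - r * a) - (y - s * a) by ring.
  exact: idealB.
- move=> b x [r xr]; exists (b * r).
  have -> : b * x - b * r * a = b * (x - r * a) by ring.
  exact: ideal_mull.
Qed.

Lemma sub_ideal_add I a : I `<=` ideal_add I a.
Proof. by move=> x Ix; exists 0; rewrite mul0r subr0. Qed.

Lemma ideal_add_gen I a : is_ideal I -> ideal_add I a a.
Proof. by move=> iI; exists 1; rewrite mul1r subrr; exact: ideal0. Qed.

Lemma maximal_idealP I : maximal_ideal I <->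
  [/\ is_ideal I, ~ I 1 & forall a, ~ I a -> exists r, I (1 - r * a)].
Proof.
split=> [[iI In maxI]|[iI I1 maxI]].
  split=> //.
    move=> I1; apply: In; apply/seteqP; split=> // x _.
    by rewrite -[x]mulr1; exact: ideal_mull.
  move=> a Ia; apply: contrapT => nr; apply: Ia.
  rewrite -(maxI (ideal_add I a)); first exact: ideal_add_gen.
  - exact: ideal_add_ideal.
  - exact: sub_ideal_add.
  - by move=> eT; apply: nr; have : ideal_add I a 1 by rewrite eT.
split=> //; first by move=> IT; apply: I1; rewrite IT.
move=> J iJ IJ JT; apply/seteqP; split=> // a Ja.
apply: contrapT => /maxI[r /IJ Jr]; apply: JT; apply/seteqP; split=> // x _.
rewrite -[x]mulr1; apply: ideal_mull => //; rewrite -[1](subrK (r * a)).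
by apply: idealD => //; exact: ideal_mull.
Qed.

Lemma maximal_ideal_prime I : maximal_ideal I -> prime_ideal I.
Proof.
move=> /maximal_idealP[iI I1 maxI]; split=> // x y Ixy.
have [Ix|/maxI[r Ir]] := pselect (I x); [by left|right].
rewrite (_ : y = (1 - r * x) * y + r * (x * y)); last by ring.
by apply: idealD => //; [exact: ideal_mulr|exact: ideal_mull].
Qed.

(** The last clause is maximality of [J]. Taking [S] to be the unit alone yields maximal ideals;
    taking the powers of an element yields primes. *)
Lemma ideal_avoiding I (S : set T) : is_ideal I -> I `&` S = set0 ->
  exists J, [/\ is_ideal J, I `<=` J, J `&` S = set0 &
    forall a, ~ J a -> exists s r, S s /\ J (s - r * a)].
Proof.
move=> iI IS.
have [||J [[iJ JS] IJ maxJ]] := @Zorn_above T [set J | is_ideal J /\ J `&` S = set0] I.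
- by [].
- move=> F FQ [J0 FJ0] Ftot; split; last first.
    by apply/seteqP; split=> // x [[J FJ Jx] Sx]; have [_ <-] := FQ _ FJ.
  split.
  + by exists J0 => //; apply: ideal0; have [] := FQ _ FJ0.
  + move=> x y Fx Fy; have [Z [FZ Zx Zy]] := chain_pair Ftot Fx Fy.
    by exists Z => //; apply: idealB => //; have [] := FQ _ FZ.
  + move=> r x [Z FZ Zx]; exists Z => //.
    by apply: ideal_mull => //; have [] := FQ _ FZ.
exists J; split=> // a Ja; apply: contrapT => nsr; apply: Ja.
rewrite -(maxJ (ideal_add J a)); first exact: ideal_add_gen.
- split; first exact: ideal_add_ideal.
  by apply/seteqP; split=> // s [[r Jsr] Ss]; apply: nsr; exists s, r.
- exact: sub_ideal_add.
Qed.

Lemma exists_maximal_ideal I : is_ideal I -> ~ I 1 ->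
  exists2 J, maximal_ideal J & I `<=` J.
Proof.
move=> iI I1; have [|J [iJ IJ J1 maxJ]] := @ideal_avoiding I [set 1] iI.
  by apply/seteqP; split=> // x [Ix /= x1]; apply: I1; rewrite -x1.
exists J => //; apply/maximal_idealP; split=> //.
  by move=> J1'; have : (J `&` [set 1]) 1 by []; rewrite J1.
by move=> a /maxJ[_ [r [-> Jr]]]; exists r.
Qed.

Lemma reduced_prime_eq0 (f : T) : reduced T ->
  (forall P, prime_ideal P -> P f) -> f = 0.
Proof.
move=> redT fP; apply: contrapT => f0.
have [||J [iJ _ JS maxJ]] := @ideal_avoiding [set 0] (range (GRing.exp f)).
- split=> [//|x y -> ->|r x ->]; [exact: subrr|exact: mulr0].
- by apply/seteqP; split=> // x [-> [n _ fn]]; apply: f0; exact: redT fn.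
have nJ n : ~ J (f ^+ n).
  by move=> Jn; have : (J `&` range (GRing.exp f)) (f ^+ n) by []; rewrite JS.
suff /fP : prime_ideal J by rewrite -[f]expr1; exact: nJ.
split=> //; first by rewrite -(expr0 f); exact: nJ.
move=> x y Jxy; apply: contrapT => /not_orP[].
move=> /maxJ[_ [r [[n _ <-] Jr]]] /maxJ[_ [s [[m _ <-] Js]]].
apply: (nJ (n + m)%N).
rewrite (_ : f ^+ (n + m) = (f ^+ n - r * x) * f ^+ m
   + (r * x) * (f ^+ m - s * y) + (r * s) * (x * y)); last by rewrite exprD; ring.
by do ![apply: idealD => //]; [exact: ideal_mulr|exact: ideal_mull|exact: ideal_mull].
Qed.
End Ideals.

Section Subrings.
Variable R : comNzRingType.

Definition subring_pred (S : set R) (_ : is_subring S) (x : R) : bool := `[< S x >].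

Lemma subring_pred_closed (S : set R) (hS : is_subring S) :
  subring_closed (subring_pred hS).
Proof.
case: (hS) => S1 SB SM; split; rewrite ?/in_mem /=; first exact/asboolP.
  by move=> x y /asboolP Sx /asboolP Sy; apply/asboolP; exact: SB.
by move=> x y /asboolP Sx /asboolP Sy; apply/asboolP; exact: SM.
Qed.

HB.instance Definition _ (S : set R) (hS : is_subring S) :=
  GRing.isSubringClosed.Build R (subring_pred hS) (subring_pred_closed hS).

Lemma in_subring (S : set R) (hS : is_subring S) x :
  x \in subring_pred hS <-> S x.
Proof. by split=> [/asboolP //|Sx]; apply/asboolP. Qed.

Definition subring_type (S : set R) (hS : is_subring S) :=
  {x : R | x \in subring_pred hS}.
HB.instance Definition _ (S : set R) (hS : is_subring S) :=
  [isSub for (@sval R (fun x => x \in subring_pred hS)) : subring_type hS -> R].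
HB.instance Definition _ (S : set R) (hS : is_subring S) :=
  [Choice of subring_type hS by <:].
HB.instance Definition _ (S : set R) (hS : is_subring S) :=
  [SubChoice_isSubComNzRing of subring_type hS by <:].

Implicit Type S : set R.

Lemma subring1 S : is_subring S -> S 1. Proof. by case. Qed.
Lemma subringB S x y : is_subring S -> S x -> S y -> S (x - y).
Proof. by case=> _ h _; exact: h. Qed.
Lemma subringM S x y : is_subring S -> S x -> S y -> S (x * y).
Proof. by case=> _ _; exact. Qed.
Lemma subring0 S : is_subring S -> S 0.
Proof. by move=> hS; apply/(in_subring hS); exact: rpred0. Qed.
Lemma subringN S x : is_subring S -> S x -> S (- x).
Proof. by move=> hS /(in_subring hS) Sx; apply/(in_subring hS); rewrite rpredN. Qed.
Lemma subringD S x y : is_subring S -> S x -> S y -> S (x + y).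
Proof.
by move=> hS /(in_subring hS) Sx /(in_subring hS) Sy; apply/(in_subring hS); exact: rpredD.
Qed.
Lemma subringX S x n : is_subring S -> S x -> S (x ^+ n).
Proof. by move=> hS /(in_subring hS) Sx; apply/(in_subring hS); exact: rpredX. Qed.
Lemma subringMn S x n : is_subring S -> S x -> S (x *+ n).
Proof. by move=> hS /(in_subring hS) Sx; apply/(in_subring hS); exact: rpredMn. Qed.

Lemma chain_subring (F : set (set R)) : F !=set0 -> total_on F subset ->
  (forall S, F S -> is_subring S) -> is_subring (\bigcup_(S in F) S).
Proof.
move=> [S0 FS0] Ftot Fsub; split.
- by exists S0 => //; apply: subring1; exact: Fsub.
- move=> x y Fx Fy; have [Z [FZ Zx Zy]] := chain_pair Ftot Fx Fy.
  by exists Z => //; apply: subringB => //; exact: Fsub.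
- move=> x y Fx Fy; have [Z [FZ Zx Zy]] := chain_pair Ftot Fx Fy.
  by exists Z => //; apply: subringM => //; exact: Fsub.
Qed.

(** Take [S] maximal among the subrings over [S0] without a pair related by [E]: a strictly larger
    subring contains such a pair, hence is everything. *)
Lemma maximal_subring_of_bad (E : R -> R -> Prop) (S0 : set R) : is_subring S0 ->
  (forall a b, S0 a -> S0 b -> ~ E a b) -> (exists a b, E a b) ->
  (forall S, is_subring S -> S0 `<=` S -> (exists a b, [/\ S a, S b & E a b]) ->
     S = setT) ->
  exists S, maximal_subring S.
Proof.
move=> hS0 S0E [a0 [b0 E0]] SE.
have [||S [[hS nE] S0S maxS]] := @Zorn_above R
   [set S | is_subring S /\ forall a b, S a -> S b -> ~ E a b] S0.
- by [].
- move=> F FQ F0 Ftot; split.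
    by apply: chain_subring => // S /FQ[].
  move=> a b Fa Fb; have [Z [FZ Za Zb]] := chain_pair Ftot Fa Fb.
  by have [_] := FQ _ FZ; exact.
exists S; split=> //; first by move=> ST; apply: (nE a0 b0) => //; rewrite ST.
move=> S' hS' SS' S'T; apply: maxS => //; split=> // a b S'a S'b Eab.
by apply: S'T; apply: SE => //; [exact: subset_trans S0S SS'|exists a, b].
Qed.

Lemma maximal_subring_of_generator (S0 : set R) (u : R) : is_subring S0 -> ~ S0 u ->
  (forall t, exists r s, [/\ S0 r, S0 s & t = r + s * u]) ->
  exists S, maximal_subring S.
Proof.
move=> hS0 S0u gen; apply: (@maximal_subring_of_bad (fun a _ => a = u) S0) => //.
- by move=> a b S0a _ au; apply: S0u; rewrite -au.
- by exists u, u.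
- move=> S hS S0S [a [_ [Sa _ au]]]; apply/seteqP; split=> // t _.
  have [r [s [S0r S0s ->]]] := gen t.
  apply: subringD; [by []|exact: S0S|apply: subringM => //; first exact: S0S].
  by rewrite -au.
Qed.

End Subrings.

(* [S] plays the role of a valuation ring of rank one in [K] with [phi x] in its
   maximal ideal, and [x], [1 - x y] generate the unit ideal of [T]. *)
Lemma maximal_subring_of_valuation (T : comNzRingType) (K : fieldType)
    (phi : {rmorphism T -> K}) (S : set K) (x y : T) : is_subring S ->
  phi x != 0 -> S (phi x) -> ~ S (phi x)^-1 -> S ((phi x)^-1 - phi y) ->
  (forall t, exists N, S (phi x ^+ N * phi t)) ->
  exists S' : set T, maximal_subring S'.
Proof.
move=> hS x0 Sx Sxv Sz Sarch; set w := 1 - x * y.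
have phiw : phi w = phi x * ((phi x)^-1 - phi y).
  by rewrite mulrBr divff // /w rmorphB rmorph1 rmorphM.
set S0 := [set t | S (phi t)].
have hS0 : is_subring S0.
  split; rewrite /S0 /=.
  - by rewrite rmorph1; exact: subring1.
  - by move=> a b Sa Sb; rewrite rmorphB; exact: subringB.
  - by move=> a b Sa Sb; rewrite rmorphM; exact: subringM.
apply: (@maximal_subring_of_bad T (fun a b => x * a + w * b = 1) S0) => //.
- move=> a b Sa Sb /(congr1 phi); rewrite rmorphD !rmorphM rmorph1 phiw => e.
  apply: Sxv; suff -> : (phi x)^-1 = phi a + ((phi x)^-1 - phi y) * phi b.
    by apply: subringD => //; exact: subringM.
  by by apply: (mulfI x0); rewrite divff // -{}e [RHS]mulrDr [in RHS]mulrA.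
- by exists y, 1; rewrite /w; ring.
- move=> S' hS' S0S' [a [b [S'a S'b e]]]; apply/seteqP; split=> // t _.
  have [N SN] := Sarch t.
  (* Each term of the binomial expansion contains [x ^+ (N - i) * w ^+ i * t], whose image is
     [phi x ^+ N * phi t] times a power of an element of [S]. *)
  have -> : t = (x * a + w * b) ^+ N * t by rewrite e expr1n mul1r.
  rewrite exprDn mulr_suml.
  have key (i : 'I_N.+1) : S' (x ^+ (N - i) * w ^+ i * t).
    apply: S0S'; rewrite /S0 /= !rmorphM !rmorphXn phiw exprMn.
    rewrite (_ : _ * _ = phi x ^+ N * phi t * ((phi x)^-1 - phi y) ^+ i).
      by apply: subringM => //; exact: subringX.
    have -> : phi x ^+ N = phi x ^+ (N - i) * phi x ^+ i.
      by rewrite -exprD subnK // -ltnS.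
    by ring.
  apply/(in_subring hS'); apply: rpred_sum => i _; apply/(in_subring hS').
  rewrite !exprMn mulrnAl; apply: subringMn => //.
  rewrite (_ : _ * t = (x ^+ (N - i) * w ^+ i * t) * (a ^+ (N - i) * b ^+ i)); last by ring.
  by apply: subringM => //; apply: subringM => //; exact: subringX.
Qed.

(** * Algebraic elements and valuations *)

(** Multiplying a monic relation of degree [n.+1] by [f y ^+ n] leaves the inverse plus an element
    of the image of [f]. *)
Lemma integral_over_inv (R : comNzRingType) (K : fieldType) (f : {rmorphism R -> K})
    (y : R) : f y != 0 -> integralOver f (f y)^-1 -> exists r, (f y)^-1 = f r.
Proof.
move=> y0 [p monp /rootP].
have [n sp] : exists n, size p = n.+1.
  by exists (size p).-1; rewrite prednK // size_poly_gt0 monic_neq0.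
have lp : p`_n = 1 by rewrite -(monicP monp) /lead_coef sp.
rewrite horner_coef size_map_poly_id0; last by rewrite (monicP monp) rmorph1 oner_neq0.
rewrite sp big_ord_recr /= coef_map /= lp rmorph1 mul1r.
case: n sp lp => [|n] sp lp.
  by rewrite big_ord0 expr0 add0r => /eqP; rewrite oner_eq0.
move=> /(congr1 ( *%R (f y ^+ n))); rewrite mulr0 mulrDr exprSr mulrA -exprMn divff //.
rewrite expr1n mul1r addrC => /eqP; rewrite addr_eq0 => /eqP ->.
exists (- \sum_(i < n.+1) p`_i * y ^+ (n - i)).
rewrite rmorphN rmorph_sum mulr_sumr; congr (- _); apply: eq_bigr => i _.
have -> : f y ^+ n = f y ^+ (n - i) * f y ^+ i by rewrite -exprD subnK // -ltnS.
rewrite coef_map /= rmorphM rmorphXn mulrCA -mulrA -exprMn.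
by rewrite divff // expr1n mulr1.
Qed.

Section AlgebraicOver.
Variable K : fieldType.
Implicit Types (A B L : set K) (p q g : {poly K}).

Definition poly_over A p := forall i, A p`_i.

Lemma poly_overP A (hA : is_subring A) p :
  p \is a polyOver (subring_pred hA) <-> poly_over A p.
Proof.
by split=> [/polyOverP Ap i|Ap]; [exact/(in_subring hA)|
  apply/polyOverP => i; exact/(in_subring hA)].
Qed.

Definition algebraic_over A (t : K) :=
  exists q, [/\ q != 0, poly_over A q & q.[t] = 0].

Definition adjoin A (x : K) : set K := [set g.[x] | g in poly_over A].

Lemma sub_poly_over A B p : A `<=` B -> poly_over A p -> poly_over B p.
Proof. by move=> AB Ap i; exact: AB. Qed.

Lemma sub_algebraic_over A B t : A `<=` B -> algebraic_over A t -> algebraic_over B t.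
Proof. by move=> AB [q [q0 Aq qt]]; exists q; split=> //; exact: sub_poly_over Aq. Qed.

Lemma poly_overC A c : is_subring A -> A c -> poly_over A c%:P.
Proof. by move=> hA Ac; apply/(poly_overP hA); rewrite polyOverC; exact/(in_subring hA). Qed.

Lemma poly_overX A : is_subring A -> poly_over A 'X.
Proof. by move=> hA; apply/(poly_overP hA); exact: polyOverX. Qed.

Lemma adjoin_subring A x : is_subring A -> is_subring (adjoin A x).
Proof.
move=> hA; split.
- by exists 1; rewrite ?hornerE //; exact/(poly_overP hA)/rpred1.
- move=> _ _ [p /(poly_overP hA) Ap <-] [q /(poly_overP hA) Aq <-].
  by exists (p - q); rewrite ?hornerE //; exact/(poly_overP hA)/rpredB.
- move=> _ _ [p /(poly_overP hA) Ap <-] [q /(poly_overP hA) Aq <-].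
  by exists (p * q); rewrite ?hornerE //; exact/(poly_overP hA)/rpredM.
Qed.

Lemma sub_adjoin A x : is_subring A -> A `<=` adjoin A x.
Proof. by move=> hA a Aa; exists a%:P; rewrite ?hornerE //; exact: poly_overC. Qed.

Lemma adjoin_gen A x : is_subring A -> adjoin A x x.
Proof. by move=> hA; exists 'X; rewrite ?hornerE //; exact: poly_overX. Qed.

Lemma algebraic_over_mem A t : is_subring A -> A t -> algebraic_over A t.
Proof.
move=> hA At; exists ('X - t%:P); split; rewrite ?polyXsubC_eq0 ?hornerE ?subrr //.
by apply/(poly_overP hA); rewrite polyOverXsubC; exact/(in_subring hA).
Qed.

(* Exchange: read a relation [\sum_i g_i(t) x^i = 0] as a polynomial in [t]. *)
Lemma algebraic_over_exchange A x t : is_subring A -> ~ algebraic_over A x ->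
  algebraic_over (adjoin A t) x -> algebraic_over (adjoin A x) t.
Proof.
move=> hA trx [p [p0 Lp px]].
have /choice[g gP] : forall i, exists gi, poly_over A gi /\ gi.[t] = p`_i.
  by move=> i; have [gi Agi git] := Lp i; exists gi.
pose q := \sum_(i < size p) x ^+ i *: g i.
have coefq j : q`_j = (\poly_(i < size p) (g i)`_j).[x].
  rewrite coef_sum horner_poly; apply: eq_bigr => i _.
  by rewrite coefZ mulrC.
have Aj j : poly_over A (\poly_(i < size p) (g i)`_j).
  move=> i; rewrite coef_poly; case: ifP => _; last exact: subring0.
  by have [] := gP i.
exists q; split.
(* If [q] vanished, each coefficient would be a relation for [x] over [A]; transcendence then kills
   every [g i], and with them [p]. *)
- apply: contra_neq p0 => q0; apply/polyP => i; rewrite coef0.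
  have [lt_ip|ge_ip] := ltnP i (size p); last by rewrite nth_default.
  have [_ <-] := gP i; suff -> : g i = 0 by rewrite horner0.
  apply/polyP => j; rewrite coef0; apply: contrapT => gij; apply: trx.
  exists (\poly_(i < size p) (g i)`_j); split=> //; last by rewrite -coefq q0 coef0.
  apply/eqP => /(congr1 (fun r : {poly K} => r`_i)).
  by rewrite coef_poly lt_ip coef0.
- by move=> j; rewrite coefq; exists (\poly_(i < size p) (g i)`_j).
- transitivity p.[x]; last exact: px.
  rewrite /q horner_sum [RHS]horner_coef; apply: eq_bigr => i _.
  by rewrite hornerZ mulrC; have [_ ->] := gP i.
Qed.

Lemma algebraic_over_comp_linear A t a b : is_subring A -> A a -> A b -> a != 0 ->
  algebraic_over A (a * t + b) -> algebraic_over A t.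
Proof.
move=> hA Aa Ab a0 [q [q0 Aq qt]].
exists (q \Po (a *: 'X + b%:P)); split.
- rewrite comp_poly2_eq0 // size_polyDl size_scale ?size_polyX //.
  by rewrite ltnS size_polyC_leq1.
- apply/(poly_overP hA)/polyOver_comp; first exact/(poly_overP hA).
  apply: rpredD; last by apply/(poly_overP hA); exact: poly_overC.
  rewrite -mul_polyC; apply: rpredM; last exact: polyOverX.
  by apply/(poly_overP hA); exact: poly_overC.
- by rewrite horner_comp !hornerE.
Qed.

Lemma algebraic_over_inv A t : is_subring A -> algebraic_over A t ->
  algebraic_over A t^-1.
Proof.
move=> hA; have [->|t0] := eqVneq t 0; first by rewrite invr0.
move=> [q [q0 Aq qt]].
exists (\poly_(i < size q) q`_((size q).-1 - i)%N); split.
- apply/eqP => /(congr1 (fun r : {poly K} => r`_0)); rewrite coef_poly coef0.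
  rewrite size_poly_gt0 q0 subn0 -/(lead_coef q) => /eqP.
  by rewrite lead_coef_eq0; exact/negP.
- by move=> i; rewrite coef_poly; case: ifP => // _; exact: subring0.
- apply: (mulfI (expf_neq0 (size q).-1 t0)); rewrite mulr0; transitivity q.[t]; last exact: qt.
  rewrite horner_poly horner_coef mulr_sumr.
  rewrite [RHS](reindex_inj rev_ord_inj) /=; apply: eq_bigr => i _.
  have lt_i := ltn_ord i.
  have -> : ((size q).-1 - i)%N = (size q - i.+1)%N by lia.
  rewrite mulrCA; congr (_ * _).
  have aux (a b : nat) : (b < a)%N -> (a.-1 = a - b.+1 + b)%N by lia.
  rewrite {1}(aux _ _ lt_i).
  by rewrite exprD -mulrA -exprMn divff // expr1n mulr1.
Qed.

Section Valuation.
Variables (A : set K) (x : K).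
Hypotheses (hA : is_subring A) (Ax : A x) (x0 : x != 0).

(** The complement in [A] of the ideal [x A]. The three hypotheses make this ideal proper and prime,
    and the localization [R0] there a discrete valuation ring with uniformizer [x]. *)
Let outside (u : K) := A u /\ ~ exists2 b, A b & u = x * b.
Hypothesis outside1 : ~ exists2 b, A b & 1 = x * b.
Hypothesis outsideM : forall u v, A u -> (~ exists2 b, A b & u = x * b) ->
  A v -> (~ exists2 b, A b & v = x * b) -> ~ exists2 b, A b & u * v = x * b.
Hypothesis factor : forall a, A a -> a != 0 ->
  exists N u, [/\ A u, ~ (exists2 b, A b & u = x * b) & a = x ^+ N * u].

Let R0 : set K := [set a / u | a in A & u in outside].

Let outside_neq0 u : outside u -> u != 0.
Proof.
move=> [_ nu]; apply/eqP => u0; apply: nu; exists 0; first exact: subring0.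
by rewrite u0 mulr0.
Qed.

Let hR0 : is_subring R0.
Proof.
have o1 : outside 1 by split=> //; exact: subring1.
have oM u v : outside u -> outside v -> outside (u * v).
  by move=> [Au nu] [Av nv]; split; [exact: subringM|exact: outsideM].
split.
- by exists 1; [exact: subring1|exists 1; rewrite ?divr1].
- move=> _ _ [a Aa [u ou <-]] [b Ab [v ov <-]].
  have [u0 v0] := (outside_neq0 ou, outside_neq0 ov).
  exists (a * v - b * u).
    by apply: subringB => //; apply: subringM => //; [case: ov|case: ou].
  exists (u * v); first exact: oM.
  by field; rewrite u0 v0.
- move=> _ _ [a Aa [u ou <-]] [b Ab [v ov <-]].
  exists (a * b); first exact: subringM.
  by exists (u * v); [exact: oM|rewrite invfM; ring].
Qed.

Let ival : {rmorphism subring_type hR0 -> K} := \val.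

Let integral_mem t : R0 t -> integralOver ival t.
Proof.
move=> /(in_subring hR0) R0t.
have -> : t = ival (exist _ t R0t) by [].
exact: integral_id.
Qed.

(* The valuation ring is replaced by the integral closure of [A] localized at [x A]. *)
Lemma valuation_subring (E : set K) : (forall t, E t -> algebraic_over A t) ->
  exists S, [/\ is_subring S, A `<=` S, ~ S x^-1 &
    forall t, E t -> exists N, S (x ^+ N * t)].
Proof.
move=> algE.
have AR0 : A `<=` R0.
  move=> a Aa; exists a => //; exists 1; last exact: divr1.
  by split=> //; exact: subring1.
exists [set t | integralOver ival t]; split.
- split; [exact: integral1|move=> a b; exact: integral_sub|move=> a b; exact: integral_mul].
- by move=> a /AR0; exact: integral_mem.
- have [x' x'x] : exists x', x = ival x'.
    have /(in_subring hR0) R0x := AR0 _ Ax.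
    by exists (exist _ x R0x).
  (* If integral, the inverse of [x] lies in [R0]; written [a / u] it gives [u = x * a], against [u]
     lying outside [x A]. *)
  rewrite /= {1}x'x => /integral_over_inv-[|r]; first by rewrite -x'x.
  rewrite -x'x => xr.
  have : R0 x^-1 by rewrite xr; apply/(in_subring hR0); exact: (svalP r).
  move=> [a Aa [u ou au]]; case: (ou) => _; apply; exists a => //.
  by apply: (mulfI (invr_neq0 x0)); rewrite mulrA mulVf // mul1r -au divfK // outside_neq0.
- move=> t /algE[q [q0 Aq qt]].
  have lq0 : lead_coef q != 0 by rewrite lead_coef_eq0.
  have [N [u [Au nu cq]]] := factor (Aq (size q).-1) lq0.
  exists N.
  have ou : outside u by [].
  have u0 := outside_neq0 ou.
  case sq: (size q) => [|[|n]].
  + by move: q0; rewrite -size_poly_eq0 sq.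
  + have /eqP := qt; rewrite horner_coef sq big_ord1 expr0 mulr1.
    have := q0; rewrite -lead_coef_eq0 /lead_coef sq /=.
    by move=> /negPf ->.
  (* The leading coefficient being [x ^+ N * u], multiplying the relation by [x ^+ (N * n) / u]
     makes it monic in [x ^+ N * t], with coefficients in [R0]. *)
  pose r := \poly_(i < n.+1) (q`_i / u * x ^+ (N * (n - i))).
  have sr : (size r < size ('X^(n.+1) : {poly K})%R)%N by rewrite size_polyXn ltnS size_poly.
  apply: (@integral_root_monic _ _ ival _ ('X^(n.+1) + r)).
  + by rewrite monicE lead_coefDl // lead_coefXn.
  + apply/rootP; rewrite hornerD hornerXn horner_poly.
    apply: (mulfI u0); rewrite mulr0 mulrDr mulr_sumr.
    transitivity (x ^+ (N * n) * q.[t]); last by rewrite qt mulr0.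
    rewrite horner_coef sq [in RHS]big_ord_recr /= [RHS]mulrDr [RHS]addrC mulr_sumr.
    congr (_ + _).
      move: cq; rewrite /lead_coef sq /= => ->.
      by rewrite exprMn -exprM mulnSr exprD; ring.
    apply: eq_bigr => i _; rewrite exprMn -exprM.
    have -> : (N * n = N * (n - i) + N * i)%N.
      by rewrite -mulnDr subnK // -ltnS.
    by rewrite exprD; field.
  + apply/integral_poly => i; rewrite coefD coefXn coef_poly.
    apply: integral_add; first exact: integral_nat.
    case: ifP => _; last exact: integral0.
    apply: integral_mem; apply: subringM => //; last by apply: AR0; exact: subringX.
    by exists q`_i => //; exists u.
Qed.
End Valuation.
End AlgebraicOver.

(** * Valuations at a transcendental element and at a prime number *)

Section Transcendental.
Variable K : fieldType.
Implicit Types (A B L : set K) (p q g h : {poly K}).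

Lemma chain_poly_over (F : set (set K)) p : F !=set0 -> total_on F subset ->
  (forall L, F L -> is_subring L) -> poly_over (\bigcup_(L in F) L) p ->
  exists2 L, F L & poly_over L p.
Proof.
move=> [L0 FL0] Ftot Fsub Fp.
have [L FL Lp] : exists2 L, F L & forall i, (i < size p)%N -> L p`_i.
  elim: (size p) => [|n [L FL Lp]]; first by exists L0.
  have [L' FL' L'n] := Fp n.
  have [LL'|L'L] := Ftot _ _ FL FL'.
    by exists L' => // i; rewrite ltnS leq_eqVlt => /predU1P[->//|/Lp/LL'].
  by exists L => // i; rewrite ltnS leq_eqVlt => /predU1P[->|/Lp//]; exact: L'L.
exists L => // i; have [/Lp//|?] := ltnP i (size p).
by rewrite nth_default //; apply: subring0; exact: Fsub.
Qed.

Lemma poly_over_split A g : is_subring A -> poly_over A g ->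
  exists2 h, poly_over A h & g = (g`_0)%:P + 'X * h.
Proof.
move=> hA Ag; exists (\poly_(i < size g) g`_i.+1).
  by move=> i; rewrite coef_poly; case: ifP => // _; exact: subring0.
apply/polyP => -[|i]; rewrite coefD coefC coefXM /= ?addr0 // add0r coef_poly.
by case: ltnP => // ge_i; rewrite nth_default // ltnW.
Qed.

Lemma poly_over_factorX A g : is_subring A -> poly_over A g -> g != 0 ->
  exists N h, [/\ poly_over A h, h`_0 != 0 & g = 'X^N * h].
Proof.
move=> hA; move: {2}(size g) (leqnn (size g)) => n.
elim: n g => [|n IHn] g; first by rewrite leqn0 size_poly_eq0 => ->.
move=> sg Ag g0; have [g00|g00] := eqVneq g`_0 0; last first.
  by exists 0, g; rewrite expr0 mul1r.
have [h Ah gh] := poly_over_split hA Ag; rewrite g00 add0r in gh.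
have h0 : h != 0 by apply: contra_neq g0 => h0; rewrite gh h0 mulr0.
have [|//|//|N [k [Ak k0 hk]]] := IHn h.
  by move: sg; rewrite gh mulrC size_mulX.
by exists N.+1, k; rewrite gh hk exprS mulrA.
Qed.

Lemma transcendental_eq0 A x p : ~ algebraic_over A x -> poly_over A p ->
  p.[x] = 0 -> p = 0.
Proof. by move=> tr Ap px; apply/eqP/negPn/negP => p0; apply: tr; exists p. Qed.

(** By transcendence [adjoin A x] is a polynomial ring in [x], so divisibility by [x] is read off
    the constant coefficient. *)
Lemma adjoin_dvd A x g : is_subring A -> ~ algebraic_over A x -> poly_over A g ->
  (exists2 b, adjoin A x b & g.[x] = x * b) <-> g`_0 = 0.
Proof.
move=> hA tr Ag; split=> [[_ [h Ah <-] gh]|g0].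
  have : g - 'X * h = 0.
    apply: (transcendental_eq0 tr); last by rewrite !hornerE gh subrr.
    apply/(poly_overP hA); apply: rpredB; first exact/(poly_overP hA).
    by apply: rpredM; [exact: polyOverX|exact/(poly_overP hA)].
  by move=> /subr0_eq ->; rewrite coefXM.
have [h Ah gh] := poly_over_split hA Ag.
by exists h.[x]; [exists h|rewrite gh g0 !hornerE].
Qed.

(** Enlarge [B] to [L], maximal among the subrings over which [x] is transcendental. By exchange all
    of [K] is algebraic over [adjoin L x], whose [x]-adic valuation provides [S]. *)
Lemma valuation_subring_transcendental B x : is_subring B -> ~ algebraic_over B x ->
  exists S, [/\ is_subring S, B `<=` S, S x, ~ S x^-1 &
    forall t, exists N, S (x ^+ N * t)].
Proof.
move=> hB trB.
have [||L [[hL trL] BL maxL]] := @Zorn_above K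
   [set L | is_subring L /\ ~ algebraic_over L x] B.
- by [].
- move=> F FQ F0 Ftot; split.
    by apply: chain_subring => // L /FQ[].
  move=> [p [p0 Fp px]]; have [|L FL Lp] := chain_poly_over F0 Ftot _ Fp.
    by move=> L /FQ[].
  by have [_] := FQ _ FL; apply; exists p.
have hA := adjoin_subring x hL.
have algA t : algebraic_over (adjoin L x) t.
  have [Lt|Lt] := pselect (L t).
    by apply: algebraic_over_mem => //; exact: sub_adjoin.
  apply: algebraic_over_exchange => //; apply: contrapT => tr; apply: Lt.
  rewrite -(maxL (adjoin L t)); first exact: adjoin_gen.
    by split=> //; exact: adjoin_subring.
  exact: sub_adjoin.
have x0 : x != 0.
  by apply/eqP => x0; apply: trL; rewrite x0; apply: algebraic_over_mem => //; exact: subring0.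
have [||||//|S [hS AS Sx algS]] := @valuation_subring K (adjoin L x) x hA _ x0 _ _ _ setT.
- exact: adjoin_gen.
- rewrite -[1](hornerC 1 x) => /(adjoin_dvd hL trL).
  rewrite coefC /= => /(_ (poly_overC hL (subring1 hL))) /eqP.
  by rewrite oner_eq0.
- move=> _ _ [g Lg <-] ng [h Lh <-] nh; rewrite -hornerM.
  have Lgh : poly_over L (g * h).
    by apply/(poly_overP hL); apply: rpredM; exact/(poly_overP hL).
  move=> /(adjoin_dvd hL trL Lgh)/eqP; rewrite coef0M mulf_eq0 => /orP[]/eqP.
    by move=> /(adjoin_dvd hL trL Lg).
  by move=> /(adjoin_dvd hL trL Lh).
- move=> _ [g Lg <-] gx0.
  have g0 : g != 0 by apply: contra_neq gx0 => ->; rewrite horner0.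
  have [N [h [Lh h0 gh]]] := poly_over_factorX hL Lg g0.
  exists N, h.[x]; split; [by exists h| |by rewrite gh !hornerE].
  by move=> /(adjoin_dvd hL trL Lh)/eqP; exact/negP.
exists S; split=> //.
- by apply: subset_trans AS => //; apply: subset_trans BL _; exact: sub_adjoin.
- by apply: AS; exact: adjoin_gen.
- by move=> t; exact: algS.
Qed.

Definition int_image : set K := range (intr : int -> K).

Lemma int_image_subring : is_subring int_image.
Proof.
split; first by exists 1.
- by move=> _ _ [m _ <-] [n _ <-]; exists (m - n); rewrite ?rmorphB.
- by move=> _ _ [m _ <-] [n _ <-]; exists (m * n); rewrite ?rmorphM.
Qed.

Lemma valuation_subring_prime (l : nat) (E : set K) : prime l ->
  (forall n : int, n%:~R = 0 :> K -> n = 0) ->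
  (forall t, E t -> algebraic_over int_image t) ->
  exists S : set K, [/\ is_subring S, S l%:R, ~ S l%:R^-1 &
    forall t, E t -> exists N, S (l%:R ^+ N * t)].
Proof.
move=> pl char0 algE.
have inj (m n : int) : m%:~R = n%:~R :> K -> m = n.
  by move=> e; apply/subr0_eq/char0; rewrite rmorphB /= e subrr.
have dvdE (m : int) :
    (exists2 b, int_image b & m%:~R = l%:R * b) <-> (l %| `|m|)%N.
  split=> [[_ [n _ <-] e]|/dvdnP[k e]].
    have -> : m = l%:Z * n by apply: inj; rewrite e rmorphM /=.
    by rewrite abszM dvdn_mulr.
  exists (sgz m * k%:Z)%:~R; first by exists (sgz m * k%:Z).
  rewrite {1}[m]intEsg e PoszM !rmorphM /=.
  by rewrite -!pmulrn; ring.
have l0 : l%:R != 0 :> K.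
  apply/eqP => l0; have /eqP := char0 l%:Z l0.
  by rewrite -[0]/(0%:Z) eqz_nat; case: l pl {dvdE l0}.
have [||||//|S [hS AS Sx algS]] :=
    @valuation_subring K int_image l%:R int_image_subring _ l0 _ _ _ E.
- by exists l%:Z.
- by move=> /(dvdE 1); rewrite dvdn1; case: l pl {dvdE l0} => [|[]].
- move=> _ _ [m _ <-] nm [n _ <-] nn; rewrite -rmorphM => /(dvdE (m * n)).
  by rewrite abszM Euclid_dvdM // => /orP[/(dvdE m)|/(dvdE n)].
- move=> _ [m _ <-] m0.
  have : (0 < `|m|)%N.
    by rewrite absz_gt0; apply: contra_neq m0 => ->.
  move=> /(pfactor_coprime pl)[k co mk].
  exists (logn l `|m|), (sgz m * k%:Z)%:~R; split.
  + by exists (sgz m * k%:Z).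
  + move=> /dvdE; rewrite abszM /= absz_sg.
    have -> : m != 0 by apply: contra_neq m0 => ->.
    by rewrite mul1n; apply/negP; rewrite -prime_coprime.
  + rewrite {1}[m]intEsg {1}mk PoszM !rmorphM /= -!pmulrn natrX; ring.
exists S; split=> //.
by apply: AS; exists l%:Z.
Qed.

End Transcendental.

Arguments int_image K : clear implicits.
Arguments int_image_subring K : clear implicits.

(** * Prime quotients of rings without maximal subrings *)

Lemma roots_seq (K : fieldType) (p : {poly K}) : p != 0 ->
  exists s : seq K, forall y, root p y -> y \in s.
Proof.
move: {2}(size p) (leqnn (size p)) => n.
elim: n p => [|n IHn] p; first by rewrite leqn0 size_poly_eq0 => ->.
move=> sp p0; have [[a pa]|na] := pselect (exists a, root p a); last first.
  by exists [::] => y py; case: na; exists y.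
have /factor_theorem[q pq] := pa.
have q0 : q != 0 by apply: contra_neq p0 => q0; rewrite pq q0 mul0r.
have [|//|s sP] := IHn q.
  by move: sp; rewrite pq size_Mmonic ?monicXsubC // size_XsubC addn2.
exists (a :: s) => y; rewrite pq rootM root_XsubC inE.
by case/orP => [/sP->|->//]; rewrite orbT.
Qed.

(** * Countability of the algebraic elements over a simple extension *)

Section SimpleExtension.
Variables (K : fieldType) (x0 : K).

Definition int_poly_eval (l : seq int) : K :=
  \sum_(j < size l) (l`_j)%:~R * x0 ^+ j.

Definition int_poly2_eval (s : seq (seq int)) : {poly K} :=
  \poly_(i < size s) int_poly_eval (nth [::] s i).

Lemma algebraic_int_poly2 y : algebraic_over (adjoin (int_image K) x0) y ->
  exists s, int_poly2_eval s != 0 /\ root (int_poly2_eval s) y.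
Proof.
move=> [q [q0 Aq qy]].
have /choice[l lP] : forall i, exists l, int_poly_eval l = q`_i.
  move=> i; have [g gP <-] := Aq i.
  have /choice[c cP] : forall j, exists c : int, c%:~R = g`_j.
    by move=> j; have [c _ cg] := gP j; exists c.
  exists (mkseq c (size g)); rewrite /int_poly_eval size_mkseq horner_coef.
  by apply: eq_bigr => j _; rewrite nth_mkseq // cP.
exists (mkseq l (size q)).
suff -> : int_poly2_eval (mkseq l (size q)) = q by split=> //; exact/rootP.
apply/polyP => i; rewrite coef_poly size_mkseq.
case: ltnP => [lt_i|ge_i]; first by rewrite nth_mkseq.
by rewrite nth_default.
Qed.

(** An element is recorded by the code of a nonzero polynomial vanishing at it and by its position
    in a list containing the roots. *)
Lemma algebraic_simple_countable (E : set K) :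
  (forall y, E y -> algebraic_over (adjoin (int_image K) x0) y) ->
  exists e : K -> nat, forall y z, E y -> E z -> e y = e z -> y = z.
Proof.
move=> algE.
have /choice[rts rtsP] : forall s : seq (seq int), exists r : seq K,
    int_poly2_eval s != 0 -> forall y, root (int_poly2_eval s) y -> y \in r.
  move=> s; have [->|s0] := eqVneq (int_poly2_eval s) 0; first by exists [::].
  by have [r rP] := roots_seq s0; exists r.
have /choice[f fP] : forall y, exists s, E y ->
    int_poly2_eval s != 0 /\ root (int_poly2_eval s) y.
  move=> y; have [Ey|nEy] := pselect (E y); last by exists [::] => /nEy.
  by have [s sP] := algebraic_int_poly2 (algE _ Ey); exists s.
exists (fun y => pickle (f y, index y (rts (f y)))).
move=> y z /fP[fy0 fy] /fP[fz0 fz] /(pcan_inj pickleK)[fyz].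
rewrite fyz => /(congr1 (nth 0 (rts (f z)))).
rewrite !nth_index //; first exact: rtsP.
by apply: rtsP => //; rewrite -fyz.
Qed.
End SimpleExtension.

Section NoMaximalSubring.
Variable T : comNzRingType.
Hypothesis nomax : ~ exists S : set T, maximal_subring S.

Section ResidueMap.
Variables (K : fieldType) (phi : {rmorphism T -> K}).
Local Notation Z := (int_image K).
Let hZ := int_image_subring K.

(* Two algebraically independent elements [x], [y] would give a rank one
   valuation for which [x] and [1 - x y] are both small. *)
Lemma residue_transcendence_degree x y : ~ algebraic_over Z (phi x) ->
  algebraic_over (adjoin Z (phi x)) (phi y).
Proof.
move=> trx; apply: contrapT => try_; apply: nomax.
have x0 : phi x != 0.
  by apply/eqP => x0; apply: trx; rewrite x0; apply: algebraic_over_mem => //; exact: subring0.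
set z := (phi x)^-1 - phi y.
have hA := adjoin_subring (phi x) hZ.
have Ax := adjoin_gen (phi x) hZ.
have [|S [hS BS Sx Sxv SN]] := @valuation_subring_transcendental K (adjoin Z z) (phi x)
    (adjoin_subring z hZ).
  (* Were [phi x] algebraic over [adjoin Z z], exchange would make [z] algebraic over
     [adjoin Z (phi x)]; inverting, scaling and inverting again gives the same for [phi x * z],
     which is [1 - phi x * phi y]. *)
  move=> /(algebraic_over_exchange hZ trx) /(algebraic_over_inv hA) algz.
  apply: try_; apply: (@algebraic_over_comp_linear _ _ _ (- phi x) 1) => //.
  - exact: subringN.
  - exact: subring1.
  - by rewrite oppr_eq0.
  have -> : - phi x * phi y + 1 = phi x * z by rewrite /z mulrBr divff //; ring.
  rewrite -[_ * z]invrK; apply: algebraic_over_inv => //.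
  apply: (@algebraic_over_comp_linear _ _ _ (phi x) 0) => //; first exact: subring0.
  by rewrite addr0 invfM mulrA divff // mul1r.
apply: (@maximal_subring_of_valuation T K phi S x y) => //.
by apply: BS; exact: adjoin_gen.
Qed.

(** Here [phi y] is the inverse of [phi x], so the last condition on the valuation reads [S 0]. *)
Lemma residue_unit_algebraic x y : phi x * phi y = 1 -> algebraic_over Z (phi x).
Proof.
move=> xy; apply: contrapT => trx; apply: nomax.
have x0 : phi x != 0.
  by apply/eqP => x0; move/eqP: xy; rewrite x0 mul0r eq_sym oner_eq0.
have [S [hS BS Sx Sxv SN]] := valuation_subring_transcendental hZ trx.
apply: (@maximal_subring_of_valuation T K phi S x y) => //.
have -> : (phi x)^-1 = phi y by apply: (mulfI x0); rewrite xy divff.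
by rewrite subrr; exact: subring0.
Qed.

Lemma residue_prime_nonunit l y : (forall t, algebraic_over Z (phi t)) ->
  (forall n : int, n%:~R = 0 :> K -> n = 0) -> prime l -> phi l%:R * phi y <> 1.
Proof.
move=> algT char0 pl ly; apply: nomax.
have [S [hS Sx Sxv SN]] : exists S : set K, [/\ is_subring S, S l%:R, ~ S l%:R^-1 &
    forall t, range phi t -> exists N, S (l%:R ^+ N * t)].
  by apply: valuation_subring_prime => // _ [x _ <-].
have phil : phi l%:R = l%:R by rewrite rmorph_nat.
have l0 : l%:R != 0 :> K.
  by apply/eqP => l0; move/eqP: ly; rewrite phil l0 mul0r eq_sym oner_eq0.
apply: (@maximal_subring_of_valuation T K phi S l%:R y); rewrite ?phil //.
- have -> : l%:R^-1 = phi y by apply: (mulfI l0); rewrite divff // -phil ly.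
  by rewrite subrr; exact: subring0.
- by move=> t; apply: SN; exists t.
Qed.

Lemma residue_countable :
  exists e : T -> nat, forall x y, e x = e y <-> phi x = phi y.
Proof.
have [x0 algT] : exists x0, forall y, algebraic_over (adjoin Z x0) (phi y).
  have [[x trx]|nx] := pselect (exists x, ~ algebraic_over Z (phi x)).
    by exists (phi x) => y; exact: residue_transcendence_degree.
  exists 0 => y; apply: (sub_algebraic_over (@sub_adjoin K Z 0 hZ)).
  by apply: contrapT => try_; apply: nx; exists y.
have [|e eP] := @algebraic_simple_countable K x0 (range phi).
  by move=> _ [y _ <-].
exists (e \o phi) => x y /=; split=> [exy|->//].
exact: eP.
Qed.

(** Divided by a power of ['X], a relation for [phi a] has a nonzero constant term [c], and the
    remaining terms are a multiple of [phi a]. *)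
Lemma residue_int_multiple a : phi a != 0 -> algebraic_over Z (phi a) ->
  exists (c : int) d, c%:~R != 0 :> K /\ c%:~R = phi (a * d).
Proof.
move=> a0 [q [q0 Zq qa]].
have [N [h [Zh h0 qh]]] := poly_over_factorX hZ Zq q0.
have ha : h.[phi a] = 0.
  move: qa; rewrite qh !hornerE => /eqP; rewrite mulf_eq0 expf_eq0 (negPf a0) andbF.
  by move=> /eqP.
have [k Zk hk] := poly_over_split hZ Zh.
have [c _ ch] := Zh 0%N.
have [d dk] : exists d, phi d = k.[phi a].
  have /choice[f fP] : forall i, exists n : int, n%:~R = k`_i.
    by move=> i; have [n _ nk] := Zk i; exists n.
  exists (\sum_(i < size k) (f i)%:~R * a ^+ i).
  rewrite rmorph_sum horner_coef; apply: eq_bigr => i _.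
  by rewrite rmorphM rmorphXn rmorph_int fP.
exists c, (- d); split; first by rewrite ch.
rewrite ch mulrN rmorphN rmorphM dk; apply/eqP; rewrite -addr_eq0.
apply/eqP; transitivity h.[phi a] => //.
by rewrite [in RHS]hk !hornerE.
Qed.

(** The hypothesis puts [phi a] in the Jacobson radical of the image. If nonzero, it is algebraic
    because [1 + a] is a unit there, so it divides a nonzero integer [c]. Then all residues are
    algebraic and every [1 + c * k] is a unit, which fails for a suitable integer [k]. *)
Lemma residue_jacobson a : (forall b, exists y, phi (1 + a * b) * phi y = 1) ->
  phi a = 0.
Proof.
move=> aU; apply/eqP/negPn/negP => a0.
have algU b : algebraic_over Z (phi (1 + a * b)).
  by have [y] := aU b; exact: residue_unit_algebraic.
have alga : algebraic_over Z (phi a).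
  apply: (@algebraic_over_comp_linear _ _ _ 1 1); rewrite ?oner_neq0 //;
    try exact: subring1.
  by have := algU 1; rewrite mulr1 rmorphD rmorph1 addrC mul1r.
have [c [d [c0 cd]]] := residue_int_multiple a0 alga.
have algT b : algebraic_over Z (phi b).
  apply: (@algebraic_over_comp_linear _ _ _ c%:~R 1) => //; try exact: subring1.
    by exists c.
  by have := algU (d * b); rewrite mulrA rmorphD rmorph1 rmorphM -cd addrC.
have unit_int (k : int) : exists y, (1 + c * k)%:~R * phi y = 1.
  have [y] := aU (d * k%:~R); rewrite mulrA rmorphD rmorph1 rmorphM -cd rmorph_int.
  by exists y; rewrite rmorphD rmorph1 rmorphM.
have [char0|] := pselect (forall n : int, n%:~R = 0 :> K -> n = 0); last first.
  move=> /existsNP[n /not_implyP[n0 /eqP nn]].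
  have ngt0 : (0 < `|n|)%N by rewrite absz_gt0.
  have n0' : `|n|%N%:R == 0 :> K by rewrite pmulrn abszEsg rmorphM /= n0 mulr0.
  have [p pK] := natf0_pchar ngt0 n0'; have pp := pcharf_prime pK.
  have cop : coprimez p%:Z c.
    rewrite coprimezE /= prime_coprime //; apply: contra c0 => /dvdnP[k ck].
    by rewrite [c]intEsg ck PoszM !rmorphM /= -!pmulrn (pcharf0 pK) !mulr0.
  have [[u v] /= uv] := coprimezP _ _ cop.
  (* By the Bezout relation [1 - c * v] is a multiple of [p], hence zero in [K]. *)
  have [y] := unit_int (- v).
  have -> : (1 + c * - v)%:~R = 0 :> K.
    rewrite -uv (_ : _ + _ = u * p%:Z); last by ring.
    by rewrite rmorphM /= -pmulrn (pcharf0 pK) mulr0.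
  by rewrite mul0r => /esym/eqP; rewrite oner_eq0.
have c0' : c != 0 by apply: contra_neq c0 => ->.
(* The choice [k = c] makes [1 + c * k] exceed 1, so it has a prime factor, which would be a
   unit. *)
have [y] := unit_int c.
set N := (1 + `|c| * `|c|)%N.
have -> : 1 + c * c = N%:Z.
  by rewrite /N; case: (c) => n; rewrite ?NegzE ?mulrNN PoszD PoszM.
have N1 : (1 < N)%N by rewrite /N; have : (0 < `|c|)%N; [rewrite absz_gt0|lia].
have /dvdnP[m Nm] := pdiv_dvd N.
move=> Ny; apply: (@residue_prime_nonunit (pdiv N) (m%:R * y)) => //.
  exact: pdiv_prime.
by rewrite rmorphM !rmorph_nat mulrA -natrM mulnC -Nm pmulrn.
Qed.
End ResidueMap.

Lemma prime_quotient_countable (P : set T) : prime_ideal P ->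
  exists e : T -> nat, forall x y, e x = e y <-> P (x - y).
Proof.
move=> /residue_field[K [phi phiP]].
have [e eP] := residue_countable phi; exists e => x y.
rewrite eP -phiP rmorphB; split=> [->|/subr0_eq //]; exact: subrr.
Qed.

(** If every maximal ideal above [P] contained [a], each [1 + a * b] would be a unit modulo [P], and
    [residue_jacobson] would put [a] in [P]. *)
Lemma prime_quotient_jacobson (P : set T) a : prime_ideal P -> ~ P a ->
  exists N, [/\ maximal_ideal N, P `<=` N & ~ N a].
Proof.
move=> primeP Pa; apply: contrapT => nN; apply: Pa.
have [iP _ _] := primeP.
have [K [phi phiP]] := residue_field primeP.
apply/phiP/residue_jacobson => b.
have [[y Py]|nI] := pselect (ideal_add P (1 + a * b) 1).
  exists y; rewrite mulrC -rmorphM -[RHS](rmorph1 phi).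
  by apply/esym/subr0_eq; rewrite -rmorphB; exact/phiP.
have [N maxN PN] := exists_maximal_ideal (ideal_add_ideal _ iP) nI.
have [iN N1 _] := (maximal_idealP _).1 maxN.
have Na : N a.
  apply: contrapT => Na; apply: nN; exists N; split=> //.
  by apply: subset_trans PN; exact: sub_ideal_add.
case: N1; rewrite -(addrK (a * b) 1); apply: idealB => //; last exact: ideal_mulr.
by apply: PN; exact: ideal_add_gen.
Qed.
End NoMaximalSubring.

(** * The cardinality of the spectrum *)

(* [T] is generated by one element over the equalizer of [phi] and [psi]. *)
Lemma maximal_subring_of_equalizer (T : comNzRingType) (K : fieldType)
    (phi : {rmorphism T -> K}) (psi : T -> K) (a r : T) :
  (forall x y, psi (x - y) = psi x - psi y) ->
  (forall x y, psi (x * y) = psi x * psi y) ->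
  (forall y, exists x, psi x = phi y) -> (forall x, exists y, psi x = phi y) ->
  psi a = 0 -> phi (1 - r * a) = 0 ->
  exists S : set T, maximal_subring S.
Proof.
move=> psiB psiM psi_onto psi_into psia phiu.
have psi1 : psi 1 = 1.
  have [x] := psi_onto 1; rewrite rmorph1 => x1.
  by rewrite -[LHS]mul1r -{1}x1 -psiM mulr1.
set u := 1 - r * a in phiu.
have psiu : psi u = 1 by rewrite /u psiB psiM psia psi1 mulr0 subr0.
pose S0 := [set x | psi x = phi x].
have hS0 : is_subring S0.
  split; rewrite /S0 /=; first by rewrite psi1 rmorph1.
    by move=> x y xE yE; rewrite psiB rmorphB xE yE.
  by move=> x y xE yE; rewrite psiM rmorphM xE yE.
apply: (maximal_subring_of_generator (u := u) hS0).
  by move=> /eqP; rewrite psiu phiu oner_eq0.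
(* As [phi u = 0] and [psi u = 1], adding a multiple of [u] adjusts the value of [psi] without
   changing that of [phi]. *)
have S0_onto t : exists s, phi s = phi t /\ psi s = phi t.
  have [s st] := psi_onto t; exists (t - (t - s) * u).
  by rewrite rmorphB rmorphM phiu psiB psiM psiu psiB st; split; ring.
move=> t; have [y ty] := psi_into t.
have [w [phiw psiw]] := S0_onto (y - t).
rewrite rmorphB -ty in phiw psiw.
exists (t - w * u), w; split; [|by rewrite /S0 /= phiw psiw|by rewrite subrK].
by rewrite /S0 /= psiB psiM psiw psiu rmorphB rmorphM phiu; ring.
Qed.

(* When [e] enumerates the classes modulo an ideal, this is the table of the
   operations of the quotient, hence determines it up to isomorphism. *)
Definition quotient_code (T : comNzRingType) (e : T -> nat) : set nat :=
  [set n | exists x y, n = pickle (e x, e y, e (x - y), e (x * y))].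

Section QuotientCode.
Variables (T : comNzRingType) (P Q : set T) (eP eQ : T -> nat).
Hypotheses (primeP : prime_ideal P) (primeQ : prime_ideal Q).
Hypothesis ePE : forall x y, eP x = eP y <-> P (x - y).
Hypothesis eQE : forall x y, eQ x = eQ y <-> Q (x - y).
Hypothesis codeE : quotient_code eP = quotient_code eQ.

(** Equal codes give an isomorphism from the quotient by [P] to that by [Q]. If [a] is in [P] but
    not in [Q], choose a maximal [N] over [Q] missing [a]: the map to its residue field through this
    isomorphism kills [a], the direct one does not, and their equalizer gives a maximal subring. *)
Lemma sub_prime_of_code : (~ exists S : set T, maximal_subring S) -> P `<=` Q.
Proof.
move=> nomax a Pa; apply: contrapT => Qa.
have [N [maxN QN Na]] := prime_quotient_jacobson nomax primeQ Qa.
have [_ _ gen] := (maximal_idealP _).1 maxN.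
have [K [phi phiN]] := residue_field (maximal_ideal_prime maxN).
have phi_eQ x y : eQ x = eQ y -> phi x = phi y.
  by move=> /eQE/QN/phiN; rewrite rmorphB => /subr0_eq.
have PQ x y : exists x' y', [/\ eP x = eQ x', eP y = eQ y',
    eP (x - y) = eQ (x' - y') & eP (x * y) = eQ (x' * y')].
  have : quotient_code eQ (pickle (eP x, eP y, eP (x - y), eP (x * y))).
    by rewrite -codeE; exists x, y.
  by move=> [x' [y' /(pcan_inj pickleK)[]]]; exists x', y'.
have /choice[h hE] : forall x, exists x', eQ x' = eP x.
  by move=> x; have [x' [_ [e _ _ _]]] := PQ x x; exists x'.
pose psi x := phi (h x).
have psiB x y : psi (x - y) = psi x - psi y.
  have [x' [y' [ex ey exy _]]] := PQ x y.
  rewrite -!hE in ex ey exy.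
  by rewrite /psi (phi_eQ _ _ ex) (phi_eQ _ _ ey) (phi_eQ _ _ exy) rmorphB.
have psiM x y : psi (x * y) = psi x * psi y.
  have [x' [y' [ex ey _ exy]]] := PQ x y.
  rewrite -!hE in ex ey exy.
  by rewrite /psi (phi_eQ _ _ ex) (phi_eQ _ _ ey) (phi_eQ _ _ exy) rmorphM.
have [r Nr] := gen _ Na.
apply: nomax; apply: (maximal_subring_of_equalizer (phi := phi) (psi := psi)
  (a := a) (r := r)) => //.
- move=> y; have : quotient_code eP (pickle (eQ y, eQ y, eQ (y - y), eQ (y * y))).
    by rewrite codeE; exists y, y.
  move=> [x [_ /(pcan_inj pickleK)[yx _ _ _]]]; exists x.
  by apply: phi_eQ; rewrite hE.
- by move=> x; exists (h x).
- have -> : psi a = psi 0 by apply: phi_eQ; rewrite !hE ePE subr0.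
  by rewrite -(subrr 0) psiB subrr.
- exact/phiN.
Qed.
End QuotientCode.

Definition prime_spectrum (T : comNzRingType) := {P : set T | prime_ideal P}.

Lemma prime_spectrum_inj (T : comNzRingType) (P Q : prime_spectrum T) :
  projT1 P = projT1 Q -> P = Q.
Proof.
case: P Q => [P primeP] [Q primeQ] /= e.
by move: primeP; rewrite e => primeP; congr exist; exact: Prop_irrelevance.
Qed.

Lemma prime_spectrum_code (T : comNzRingType) :
  (~ exists S : set T, maximal_subring S) ->
  exists e : prime_spectrum T -> T -> nat,
    (forall P x y, e P x = e P y <-> projT1 P (x - y)) /\
    injective (fun P => quotient_code (e P)).
Proof.
move=> nomax.
have /choice[e eE] : forall P : prime_spectrum T, exists e : T -> nat,
    forall x y, e x = e y <-> projT1 P (x - y).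
  by move=> [P primeP]; exact: prime_quotient_countable.
exists e; split=> // P Q codeE; apply: prime_spectrum_inj; apply/seteqP; split.
  by apply: (sub_prime_of_code (projT2 Q) (eE P) (eE Q)).
by apply: (sub_prime_of_code (projT2 P) (eE Q) (eE P)).
Qed.

(** * The cardinality of the ring *)

Section PatchCompactness.
Variables (T : comNzRingType) (A : Type) (s : A -> T).
Local Notation X := (prime_spectrum T).
Local Notation prime P := (projT1 P).

Hypothesis s_onto : forall (P : X) f, exists a, prime P (f - s a).
Hypothesis s_sep : forall P Q : X, (forall a, prime P (s a) <-> prime Q (s a)) -> P = Q.

(* Cells form a base of the constructible topology, because [s] separates primes. *)
Definition in_cell (c : seq (A * bool)) (P : X) : bool :=
  all (fun ab => `[< prime P (s ab.1) >] == ab.2) c.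

Definition represents (l : seq (A * seq (A * bool))) (f : T) : Prop :=
  (forall P, has (fun ac => in_cell ac.2 P) l) /\
  all (fun ac => `[< forall P, in_cell ac.2 P -> prime P (f - s ac.1) >]) l.

Lemma represents_inj l f g : reduced T -> represents l f -> represents l g -> f = g.
Proof.
move=> redT [lP lf] [_ lg]; apply/subr0_eq/reduced_prime_eq0 => // P primeP.
have [iP _ _] := primeP.
have := lP (exist _ P primeP); elim: l lf lg {lP} => //= [[a c] l] IHl.
move=> /andP[/asboolP fa lf] /andP[/asboolP ga lg] /orP[Pc|]; last exact: IHl.
have -> : f - g = (f - s a) - (g - s a) by ring.
by apply: idealB => //; [exact: (fa (exist _ P primeP))|exact: (ga (exist _ P primeP))].
Qed.

(** This is the limit of [W] in the constructible topology; being an ultrafilter is what makes it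
    prime. *)
Lemma ultra_limit_prime (W : set_system X) : UltraFilter W ->
  prime_ideal [set t | W [set P : X | prime P t]].
Proof.
move=> UW; have PW : ProperFilter W := ultra_proper.
have FW : Filter W := filter_filter.
have idealP (P : X) : is_ideal (prime P) by case: (projT2 P).
split; first split.
- by apply: filterS filterT => P _; exact: ideal0.
- move=> x y Wx Wy; apply: filterS (filterI Wx Wy) => P [Px Py]; exact: idealB.
- by move=> r x; apply: filterS => P; exact: ideal_mull.
- move=> W1; suff : W set0 by exact: filter_not_empty.
  apply: filterS W1 => P P1.
  by case: (projT2 P) => _; exact.
- move=> x y Wxy; have [|Wx] := in_ultra_setVsetC [set P : X | prime P x] UW; first by left.
  right; apply: filterS (filterI Wxy Wx) => P [Pxy nPx].
  by have [_ _ /(_ _ _ Pxy)[]] := projT2 P.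
Qed.

(* If no finite list of cells represents [f], some ultrafilter [W] avoids all
   cells on which [f] agrees with an [s a].  Replacing the locus of [f = s a] by
   its complement yields an ultrafilter [U] with the same trace on the cells, so
   both limits are the same prime, although [f - s a] lies in only one of them. *)
Lemma exists_represents f : exists l, represents l f.
Proof.
apply: contrapT => nl.
pose good (ac : A * seq (A * bool)) :=
  `[< forall P, in_cell ac.2 P -> prime P (f - s ac.1) >].
pose F1 : set_system X :=
  [set C | exists l, all good l /\ forall P, ~~ has (fun ac => in_cell ac.2 P) l -> C P].
have F1P : ProperFilter F1.
  split.
    move=> [l [gl lP]]; apply: nl; exists l; split=> // P.
    by apply/negPn/negP => /lP.
  split.
  - by exists [::].
  - move=> C D [l [gl lC]] [k [gk kD]]; exists (l ++ k); split.
      by rewrite all_cat gl.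
    by move=> P; rewrite has_cat negb_or => /andP[/lC ? /kD].
  - by move=> C D CD [l [gl lC]]; exists l; split=> // P /lC/CD.
have [W [UW F1W]] := ultraFilterLemma F1P.
have PW : ProperFilter W := ultra_proper.
have FW : Filter W := filter_filter.
pose PWX : X := exist _ _ (ultra_limit_prime UW).
have [a /= Wa] := s_onto PWX f.
pose F2 : set_system X := [set C | exists c, W [set P | in_cell c P] /\
  forall P, in_cell c P -> ~ prime P (f - s a) -> C P].
have F2P : ProperFilter F2.
  split.
    (* A cell in [W] on which [f] agrees with [s a] throughout would be good, but [W] contains the
       complements of good cells. *)
    move=> [c [Wc cP]].
    have : W [set P | ~~ in_cell c P].
      apply: F1W; exists [:: (a, c)]; split; last by move=> P /=; rewrite orbF.
      rewrite /= andbT; apply/asboolP => P /= Pc.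
      by apply: contrapT => /(cP _ Pc).
    move=> Wnc; suff : W set0 by exact: filter_not_empty.
    by apply: filterS (filterI Wc Wnc) => P [/= ->].
  split.
  - by exists [::]; split=> //; apply: filterS filterT.
  - move=> C D [b [Wb bC]] [c [Wc cD]]; exists (b ++ c); split.
      by apply: filterS (filterI Wb Wc) => P [/= Pb Pc]; rewrite /in_cell all_cat; apply/andP.
    move=> P; rewrite /in_cell all_cat => /andP[Pb Pc] nP.
    by split; [exact: bC|exact: cD].
  - by move=> C D CD [c [Wc cC]]; exists c; split=> // P Pc nP; apply/CD/cC.
have [U [UU F2U]] := ultraFilterLemma F2P.
have PU : ProperFilter U := ultra_proper.
have FU : Filter U := filter_filter.
pose PUX : X := exist _ _ (ultra_limit_prime UU).
have WU c : W [set P | in_cell c P] -> U [set P | in_cell c P].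
  by move=> Wc; apply: F2U; exists c.
have cell1 b eps P : in_cell [:: (b, eps)] P = (`[< prime P (s b) >] == eps).
  by rewrite /in_cell /= andbT.
have PE : PWX = PUX.
  apply: s_sep => b /=; split=> [Wb|Ub].
    have /WU : W [set P | in_cell [:: (b, true)] P].
      by apply: filterS Wb => P Pb; rewrite /mkset cell1; apply/eqP/asboolP.
    by apply: filterS => P; rewrite /mkset cell1 => /eqP/asboolP.
  (* Non-membership has to be transferred as well, which is why cells carry a boolean. *)
  apply: contrapT => Wb.
  have [//|nWb] := in_ultra_setVsetC [set P : X | prime P (s b)] UW.
  have /WU Unb : W [set P | in_cell [:: (b, false)] P].
    by apply: filterS nWb => P nPb; rewrite /mkset cell1; apply/eqP/asboolPn.
  suff : U set0 by exact: filter_not_empty.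
  apply: filterS (filterI Ub Unb) => P [Pb].
  by rewrite /mkset cell1 => /eqP/asboolPn.
have Ua : prime PUX (f - s a) by rewrite -PE.
have nUa : U [set P | ~ prime P (f - s a)].
  by apply: F2U; exists [::]; split=> //; apply: filterS filterT.
suff : U set0 by exact: filter_not_empty.
by apply: filterS (filterI Ua nUa) => P [].
Qed.
End PatchCompactness.

(** * Types of cardinality at most the continuum *)

Definition embeds_continuum (A : Type) := exists f : A -> set nat, injective f.

Lemma embeds_continuum_countable (C : countType) (A : Type) (f : A -> set C) :
  injective f -> embeds_continuum A.
Proof.
move=> f_inj; exists (fun a => pickle @` f a) => a b e; apply: f_inj.
apply/seteqP; split=> c fc.
  by rewrite -(image_inj (pcan_inj (@pickleK C))) -e image_inj //; exact: pcan_inj pickleK.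
by rewrite -(image_inj (pcan_inj (@pickleK C))) e image_inj //; exact: pcan_inj pickleK.
Qed.

Lemma embeds_continuum_countType (C : countType) : embeds_continuum C.
Proof.
apply: (@embeds_continuum_countable C C (fun c => [set c])) => a b e.
by have : [set b] a by rewrite -e.
Qed.

Lemma embeds_continuum_prod A B :
  embeds_continuum A -> embeds_continuum B -> embeds_continuum (A * B).
Proof.
move=> [f f_inj] [g g_inj].
apply: (@embeds_continuum_countable _ _ (fun ab : A * B =>
  [set c : bool * nat | if c.1 then f ab.1 c.2 else g ab.2 c.2])).
move=> [a b] [a' b'] e; congr (_, _); [apply: f_inj|apply: g_inj]; apply/funext => n.
  exact: (congr1 (fun S : set (bool * nat) => S (true, n)) e).
exact: (congr1 (fun S : set (bool * nat) => S (false, n)) e).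
Qed.

Lemma embeds_continuum_sum A B :
  embeds_continuum A -> embeds_continuum B -> embeds_continuum (A + B).
Proof.
move=> [f f_inj] [g g_inj].
(* [None] records the summand. *)
pose h (x : A + B) : set (option nat) := [set c | match x, c with
  | inl a, Some n => f a n | inr b, Some n => g b n
  | inl _, None => True | inr _, None => False end].
apply: (@embeds_continuum_countable _ _ h) => x y e.
have ec c : h x c = h y c by rewrite e.
case: x y ec {e} => [a|b] [a'|b'] ec.
- by congr inl; apply: f_inj; apply/funext => n; exact: (ec (Some n)).
- by exfalso; have := ec None; rewrite /h /= => <-.
- by exfalso; have := ec None; rewrite /h /= => ->.
- by congr inr; apply: g_inj; apply/funext => n; exact: (ec (Some n)).
Qed.

Lemma embeds_continuum_seq A : embeds_continuum A -> embeds_continuum (seq A).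
Proof.
move=> [f f_inj].
(* [None] marks an occupied position, so the length is recovered too. *)
pose h (l : seq A) : set (nat * option nat) := [set c | match onth l c.1, c.2 with
  | None, _ => False | Some a, None => True | Some a, Some n => f a n end].
apply: (@embeds_continuum_countable _ _ h) => x y e.
have ec c : h x c = h y c by rewrite e.
apply: eq_from_onth => i.
case ox: (onth x i) => [a|]; case oy: (onth y i) => [b|] //.
- congr Some; apply: f_inj; apply/funext => n.
  by have := ec (i, Some n); rewrite /h /= ox oy.
- by exfalso; have := ec (i, None); rewrite /h /= ox oy => <-.
- by exfalso; have := ec (i, None); rewrite /h /= ox oy => ->.
Qed.

Lemma Cantor_injection (X : Type) (f : set X -> X) : ~ injective f.
Proof.
move=> f_inj; pose D := [set x | exists2 S, f S = x & ~ S x].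
have nD : ~ D (f D) by move=> /[dup] DD [S /f_inj ->].
by apply: (nD); exists D.
Qed.

Lemma reduced_embeds_continuum (T : comNzRingType) : reduced T ->
  (~ exists S : set T, maximal_subring S) -> embeds_continuum T.
Proof.
move=> redT nomax.
have [e [eE code_inj]] := prime_spectrum_code nomax.
pose X := prime_spectrum T.
have /choice[rep repP] : forall Pn : X * nat, exists x, forall f,
    e Pn.1 f = Pn.2 -> projT1 Pn.1 (f - x).
  move=> [P n]; have [[x xn]|nx] := pselect (exists x, e P x = n).
    by exists x => f /= fn; apply/eE; rewrite fn.
  by exists 0 => f /= fn; case: nx; exists f.
have /choice[sep sepP] : forall PQ : X * X, exists x,
    PQ.1 <> PQ.2 -> ~ (projT1 PQ.1 x <-> projT1 PQ.2 x).
  move=> [P Q] /=; have [->|PQ] := pselect (P = Q); first by exists 0.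
  have [x xP] : exists x, ~ (projT1 P x <-> projT1 Q x); last by exists x.
  apply/existsNP => PQE; apply: PQ; apply: prime_spectrum_inj.
  by apply/seteqP; split=> x /PQE.
(* A prime and a class number index a representative of that class; two distinct primes index an
   element lying in exactly one of them. *)
pose s (a : X * nat + X * X) : T := match a with inl b => rep b | inr b => sep b end.
have s_onto (P : X) f : exists a, projT1 P (f - s a).
  by exists (inl (P, e P f)); exact: repP.
have s_sep (P Q : X) : (forall a, projT1 P (s a) <-> projT1 Q (s a)) -> P = Q.
  move=> PQ; apply: contrapT => nPQ.
  by apply: (sepP (P, Q) nPQ); exact: (PQ (inr (P, Q))).
have /choice[l lP] := exists_represents s_onto s_sep.
have X_emb : embeds_continuum X by exists (fun P => quotient_code (e P)).
have A_emb : embeds_continuum (X * nat + X * X).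
  apply: embeds_continuum_sum; apply: embeds_continuum_prod => //.
  exact: embeds_continuum_countType.
have [c c_inj] : embeds_continuum (seq ((X * nat + X * X) * seq ((X * nat + X * X) * bool))).
  apply: embeds_continuum_seq; apply: embeds_continuum_prod => //.
  apply: embeds_continuum_seq; apply: embeds_continuum_prod => //.
  exact: embeds_continuum_countType.
exists (c \o l) => f g /= /c_inj lfg.
by apply: (represents_inj redT (lP f)); rewrite lfg.
Qed.

(* |T| = 2^(2^aleph_0) is rendered as |T| = |set (set nat)|, and
   2^aleph_0 as |set nat|. *)
Theorem theorem2p23 (T : comNzRingType) :
  reduced T ->
  ([set: T] #= [set: set (set nat)])%card ->
  (exists S : set T, maximal_subring S) \/
  ((@MaxSpec T #= [set: set nat])%card /\
   forall F : nat -> set T, (forall n, maximal_ideal (F n)) ->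
     \bigcap_n F n <> [set 0]).
Proof.
move=> redT /card_set_bijP[g [_ _ g_onto]].
left; apply: contrapT => nomax.
have [f f_inj] := reduced_embeds_continuum redT nomax.
have /choice[h hK] : forall A, exists t, g t = A.
  by move=> A; have [t _ <-] := g_onto A I; exists t.
(* With [h] a section of [g], the composite would embed the power set of [set nat] into
   [set nat]. *)
apply: (@Cantor_injection _ (f \o h)) => A B /f_inj hAB.
by rewrite -(hK A) hAB.
Qed.
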